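(* Let $D$ be a strongly connected digraph, let $k\ge 1$ be an integer, and suppose that the $k$-iterated line digraph $L^kD$ has minimum in-degree $\delta^-\ge 2$. Then: (i) If $k\ge 2$, then $L^kD$ admits a $(1,\le 2)$-identifying code. (ii) If $k=1$ and $\delta^-\ge 3$, then $LD$ admits a $(1,\le 2)$-identifying code. (iii) If $D$ is a 2-in-regular digraph and $k\ge 1$, then $L^kD$ admits a $(1,\le 2)$-identifying code if and only if there do not exist vertices $x,y,x',y'\in V(L^kD)$ with $x'\ne x$, $y'\neq y$ such that $N^-(x)=\{y,y'\}$, $N^-(y)=\{x,x'\}$ and $N^-(x')\cap N^-(y')\ne\emptyset$ (in-neighbourhoods taken in $L^kD$).
   Context: Digraphs are finite, without loops or multiple arcs; digons (both arcs $(u,v)$ and $(v,u)$) are allowed. $N^-(u)$ and $N^+(u)$ are the in- and out-neighbourhoods, $N^-[u]=\{u\}\cup N^-(u)$, $N^+[u]=\{u\}\cup N^+(u)$, and $N^{\pm}[U]=\bigcup_{u\in U}N^{\pm}[u]$. A digraph is 2-in-regular if every vertex has in-degree 2. The line digraph $LD$ of $D$ has vertex set the arc set of $D$, and a vertex $uv$ (for the arc $(u,v)$) is adjacent to $wz$ if and only if $v=w$. Set $L^0D=D$ and $L^kD=L(L^{k-1}D)$. For an integer $\ell\ge1$, a $(1,\le\ell)$-identifying code in a digraph $G$ is a set $C\subseteq V(G)$ that is dominating ($N^+[C]=V(G)$) and such that $N^-[X]\cap C\ne N^-[Y]\cap C$ for all distinct $X,Y\subseteq V(G)$ with $1\le|X|,|Y|\le\ell$.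 $G$ admits a $(1,\le \ell)$-identifying code if one exists; equivalently, if $N^-[X]\neq N^-[Y]$ for all such distinct $X,Y$. *)

(* Defs.v *)
From HB Require Import structures.
From mathcomp Require Import all_boot.

Set Implicit Arguments.
Unset Strict Implicit.
Unset Printing Implicit Defensive.

Record digraph := Digraph {
  vert : finType;
  arc : rel vert;
  arc_irr : irreflexive arc }.

Section DigraphNotions.
Variable G : digraph.
Implicit Types (u v : vert G) (U C X Y : {set vert G}).

Definition in_nbr u : {set vert G} := [set v | arc v u].
Definition out_nbr u : {set vert G} := [set v | arc u v].

Definition in_nbr1 u : {set vert G} := u |: in_nbr u.
Definition out_nbr1 u : {set vert G} := u |: out_nbr u.

Definition in_nbrs U : {set vert G} := \bigcup_(u in U) in_nbr1 u.
Definition out_nbrs U : {set vert G} := \bigcup_(u in U) out_nbr1 u.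

(* Every in-degree is less than #|vert G|, so the default value #|vert G|
   only matters when G has no vertex, in which case the result is 0. *)
Definition min_in_degree : nat :=
  \big[minn/#|vert G|]_(u : vert G) #|in_nbr u|.

Definition in_regular (d : nat) : Prop := forall u, #|in_nbr u| = d.

Definition strongly_connected : Prop := forall u v, connect (@arc G) u v.

Definition identifying_code (l : nat) C : Prop :=
  out_nbrs C = [set: vert G] /\
  forall X Y, X <> Y -> 1 <= #|X| <= l -> 1 <= #|Y| <= l ->
    in_nbrs X :&: C <> in_nbrs Y :&: C.

Definition admits_identifying_code (l : nat) : Prop :=
  exists C, identifying_code l C.

End DigraphNotions.

Section LineDigraph.
Variable D : digraph.

Definition line_vert : finType :=
  {a : vert D * vert D | arc a.1 a.2}.

Definition line_arc : rel line_vert :=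
  fun a b => (val a).2 == (val b).1.

Lemma line_arc_irr : irreflexive line_arc.
Proof.
case=> -[u v] /= uv; rewrite /line_arc /=.
by apply/eqP=> vu; rewrite vu arc_irr in uv.
Qed.

Definition line_digraph : digraph := Digraph line_arc_irr.

End LineDigraph.

Definition iter_line (k : nat) (D : digraph) : digraph :=
  iter k line_digraph D.

(* Main.v *)
From HB Require Import structures.
From mathcomp Require Import all_boot.
Require Import Defs.

Set Implicit Arguments.
Unset Strict Implicit.
Unset Printing Implicit Defensive.

(** In a line digraph, [N^-[X]] is [X] together with all arcs whose head is the
    tail of some member of [X]. Suppose [N^-[X] = N^-[Y]] with [X <> Y] of size
    at most 2. If [X] and [Y] have the same tails, comparing heads yields a
    loop or [X = Y]. Otherwise some [x] in [X] has a tail which is no tail of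
    [Y], and this forces [N^-(x) = Y]; the two members of [Y] then have distinct
    tails, different from that of [x], so one of them is not a tail of [X] and
    [N^-(y) = X]. This is exactly the configuration of (iii), which needs
    in-degree 2. In [L(LH)] it cannot occur: it provides a digon [u, v] of [LH]
    whose ends have a common in-neighbour, hence the same tail, and then [u]
    would be a loop. *)

Definition twin_digon (G : digraph) : Prop :=
  exists x y x' y' : vert G,
    [/\ x' <> x, y' <> y, in_nbr x = [set y; y'], in_nbr y = [set x; x']
      & in_nbr x' :&: in_nbr y' <> set0].

Section Digraph.
Variable G : digraph.
Implicit Types (x y z : vert G) (X Y : {set vert G}).

Lemma min_in_degree_le x : min_in_degree G <= #|in_nbr x|.
Proof.
rewrite /min_in_degree; have: x \in index_enum (vert G) by rewrite mem_index_enum.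
elim: (index_enum _) => //= y s IHs; rewrite inE big_cons.
by case/predU1P=> [<-|/IHs]; rewrite geq_min ?leqnn // => ->; rewrite orbT.
Qed.

Lemma in_nbrsP z X :
  reflect (z \in X \/ exists2 x, x \in X & arc z x) (z \in in_nbrs X).
Proof.
apply: (iffP bigcupP) => [[x xX]|[zX|[x xX zx]]].
- by rewrite !inE => /predU1P[->|zx]; [left | right; exists x].
- by exists z => //; rewrite !inE eqxx.
- by exists x => //; rewrite !inE zx orbT.
Qed.

Lemma in_nbrs2 x y : in_nbrs [set x; y] = in_nbr1 x :|: in_nbr1 y.
Proof. by rewrite /in_nbrs bigcup_setU !big_set1. Qed.

Lemma set2_of_card (T : finType) (A : {set T}) (a b : T) :
  #|A| <= 2 -> a \in A -> b \in A -> a != b -> A = [set a; b].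
Proof.
move=> A2 aA bA ab; apply/esym/eqP; rewrite eqEcard cards2 ab A2 andbT.
by apply/subsetP=> c; rewrite !inE => /orP[]/eqP->.
Qed.

(** A larger code separates at least as well, so all vertices are taken. The empty set may be let in
    among [X] and [Y], since no other set has an empty closed in-neighbourhood. *)
Lemma admits_setT l :
    (forall X Y, X <> Y -> #|X| <= l -> #|Y| <= l -> in_nbrs X <> in_nbrs Y) ->
  admits_identifying_code G l.
Proof.
move=> inj; exists setT; split=> [|X Y XY /andP[_ Xl] /andP[_ Yl]].
  by apply/setP=> x; rewrite inE; apply/bigcupP; exists x; rewrite !inE ?eqxx.
by rewrite !setIT; apply: inj.
Qed.

End Digraph.

Section LineDigraph.
Variable H : digraph.
Local Notation G := (line_digraph H).
Implicit Types (x y z : vert G) (X Y : {set vert G}).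

Definition tail x := (val x).1.
Definition head x := (val x).2.

Lemma arc_line x y : arc x y = (head x == tail y).
Proof. by []. Qed.

Lemma line_ext x y : tail x = tail y -> head x = head y -> x = y.
Proof.
by move=> t h; apply/val_inj; rewrite (surjective_pairing (val x)) [X in (X, _)]t
  [X in (_, X)]h -surjective_pairing.
Qed.

Lemma tail_neq_head x : tail x <> head x.
Proof. by move=> th; have := valP x; rewrite -/(tail x) th arc_irr. Qed.

Lemma in_nbr_tail x y : tail x = tail y -> in_nbr x = in_nbr y.
Proof. by move=> t; apply/setP=> z; rewrite !inE !arc_line t. Qed.

Lemma in_nbr_meet x y : in_nbr x :&: in_nbr y <> set0 -> tail x = tail y.
Proof.
by move/eqP/set0Pn=> [z]; rewrite !inE !arc_line => /andP[/eqP<- /eqP<-].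
Qed.

(** The pairs [[set x; x']] and [[set y; y']] are confused by every code: each pair is the
    in-neighbourhood of a member of the other, and [x'], [y'] have the same in-neighbours. *)
Lemma twin_digon_not_admits :
  twin_digon G -> ~ admits_identifying_code G 2.
Proof.
move=> [x [y [x' [y' [/eqP x'x /eqP y'y Nx Ny /in_nbr_meet/in_nbr_tail Nx'y']]]]].
case=> C [_ /(_ [set x; x'] [set y; y'])]; rewrite !cards2.
rewrite [x == _]eq_sym x'x [y == _]eq_sym y'y; apply=> //.
  by rewrite -Nx => /setP/(_ x); rewrite !inE eqxx arc_irr.
rewrite !in_nbrs2 /in_nbr1 Nx Ny Nx'y'; congr (_ :&: _); apply/setP=> z.
by rewrite !inE; case: (z == x); case: (z == x'); case: (z == y); case: (z == y').
Qed.

Hypothesis deg2 : forall x, 2 <= #|in_nbr x|.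

Definition tails_sub X Y :=
  [forall x in X, exists y in Y, tail y == tail x].

Lemma tails_subP X Y :
  reflect (forall x, x \in X -> exists2 y, y \in Y & tail y = tail x)
          (tails_sub X Y).
Proof.
apply: (iffP forall_inP) => XY x /XY.
  by case/exists_inP=> y yY /eqP; exists y.
by case=> y yY /eqP t; apply/exists_inP; exists y.
Qed.

Lemma same_tails_sub X Y : #|X| <= 2 -> #|Y| <= 2 -> in_nbrs X = in_nbrs Y ->
  tails_sub X Y -> tails_sub Y X -> X \subset Y.
Proof.
move=> X2 Y2 NXY /tails_subP tXY /tails_subP tYX; apply/subsetP=> z zX.
apply/negPn/negP=> zY; have [y yY tyz] := tXY _ zX.
have /in_nbrsP[|[y1 y1Y]]: z \in in_nbrs Y by rewrite -NXY; apply/in_nbrsP; left.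
  by rewrite (negPf zY).
rewrite arc_line => /eqP hz.
have yy1 : y != y1.
  by apply/eqP=> e; apply: (@tail_neq_head z); rewrite hz -e.
have zy : z != y by apply: contraNneq zY => ->.
(* If [y] is in [X], both members of [X] have the tail of [z]. But [head z], the tail of [y1], must
   be a tail of [X], so [z] is a loop. *)
have /in_nbrsP[yX|[x xX]]: y \in in_nbrs X by rewrite NXY; apply/in_nbrsP; left.
  have [x] := tYX _ y1Y; rewrite (set2_of_card X2 zX yX zy) -hz.
  by case/set2P=> -> e; case: (@tail_neq_head z); rewrite -e ?tyz.
(* [head y] is a tail of [Y]: that of [y] makes [y] a loop, that of [y1] makes [y] parallel to
   [z]. *)
rewrite arc_line => /eqP hy; have [w] := tXY _ xX.
rewrite (set2_of_card Y2 yY y1Y yy1) -hy => /set2P[]-> e.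
  exact: tail_neq_head e.
by case/eqP: zy; apply: line_ext; rewrite // hz e.
Qed.

(** An in-neighbour of [x] cannot enter a member of [Y], which would then share the tail of [x]; so
    it lies in [Y]. Equality follows by counting. *)
Lemma in_nbr_eq_of_new_tail X Y x : #|Y| <= 2 -> in_nbrs X = in_nbrs Y ->
  x \in X -> (forall y, y \in Y -> tail y <> tail x) -> in_nbr x = Y.
Proof.
move=> Y2 NXY xX new; apply/eqP; rewrite eqEcard (leq_trans Y2 (deg2 x)) andbT.
apply/subsetP=> z; rewrite inE => zx.
have /in_nbrsP[//|[y /new]]: z \in in_nbrs Y.
  by rewrite -NXY; apply/in_nbrsP; right; exists x.
by move: zx; rewrite !arc_line => /eqP-> + /eqP/esym.
Qed.

Lemma new_tailP X Y : ~~ tails_sub X Y ->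
  exists2 x, x \in X & forall y, y \in Y -> tail y <> tail x.
Proof.
case/forall_inPn=> x xX /exists_inPn new; exists x => // y /new.
by move/eqP.
Qed.

Lemma twin_digon_of_new_tail X Y : #|X| <= 2 -> #|Y| <= 2 ->
  in_nbrs X = in_nbrs Y -> ~~ tails_sub X Y -> twin_digon G.
Proof.
move=> X2 Y2 NXY /new_tailP[x xX newx].
have Nx := in_nbr_eq_of_new_tail Y2 NXY xX newx.
have headY y : y \in Y -> head y = tail x by rewrite -Nx inE arc_line => /eqP.
(* Members of [Y] share a head, so their tails differ. Members of [X] with these tails would exhaust
   [X], leaving no room for [x]. *)
have /new_tailP[y yY newy]: ~~ tails_sub Y X.
  apply/negP=> /tails_subP tYX.
  have /card_gt1P[y [y' [yY y'Y /eqP yy']]]: 1 < #|Y| by rewrite -Nx.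
  have [[x1 x1X t1] [x2 x2X t2]] := (tYX _ yY, tYX _ y'Y).
  have x12 : x1 != x2.
    apply/eqP=> e; apply: yy'; apply: line_ext; first by rewrite -t1 e.
    by rewrite !headY.
  have := xX; rewrite (set2_of_card X2 x1X x2X x12).
  by case/set2P=> e; move: newx; rewrite e ?t1 ?t2; [move/(_ _ yY)|move/(_ _ y'Y)].
have Ny := in_nbr_eq_of_new_tail X2 (esym NXY) yY newy.
have headX z : z \in X -> head z = tail y by rewrite -Ny inE arc_line => /eqP.
have other (A : {set vert G}) a : 1 < #|A| -> a \in A -> exists2 b, b \in A & b != a.
  rewrite (cardsD1 a) => + aA; rewrite aA => /card_gt0P[b].
  by rewrite !inE => /andP[]; exists b.
have [|x' x'X x'x] := other X x _ xX; first by rewrite -Ny.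
have [|y' y'Y y'y] := other Y y _ yY; first by rewrite -Nx.
have Xx : X = [set x; x'] by apply: set2_of_card; rewrite // eq_sym.
have Yy : Y = [set y; y'] by apply: set2_of_card; rewrite // eq_sym.
have /card_gt0P[z zx'] : 0 < #|in_nbr x'| by apply: ltnW.
have hz : head z = tail x' by move: zx'; rewrite inE arc_line => /eqP.
(* If [z] is in [Y], then [x'] is parallel to [x]; if [z] enters [y], then [x'] is a loop. Hence [z]
   enters [y']. *)
have tx'y' : tail x' = tail y'.
  have /in_nbrsP[zY|[w]]: z \in in_nbrs Y.
  - by rewrite -NXY; apply/in_nbrsP; right; exists x' => //; rewrite arc_line hz.
  - by case/eqP: x'x; apply: line_ext; [rewrite -hz headY | rewrite !headX].
  - rewrite {1}Yy arc_line hz => /set2P[]-> /eqP // e.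
    by case: (@tail_neq_head x'); rewrite headX.
exists x, y, x', y'; split; rewrite ?Nx ?Ny //; try exact/eqP.
by apply/eqP/set0Pn; exists z; rewrite -(in_nbr_tail tx'y') setIid.
Qed.

Lemma admits_of_not_twin_digon :
  ~ twin_digon G -> admits_identifying_code G 2.
Proof.
move=> notwin; apply: admits_setT => X Y XY X2 Y2 NXY; apply: XY.
have tXY : tails_sub X Y by apply/negPn/negP=> /(twin_digon_of_new_tail X2 Y2 NXY).
have tYX : tails_sub Y X.
  by apply/negPn/negP=> /(twin_digon_of_new_tail Y2 X2 (esym NXY)).
by apply/eqP; rewrite eqEsubset !same_tails_sub.
Qed.

End LineDigraph.

Lemma line2_not_twin_digon (H : digraph) :
  ~ twin_digon (line_digraph (line_digraph H)).
Proof.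
move=> [x [y [x' [y' [_ _ Nx Ny /in_nbr_meet tx'y']]]]].
have /eqP hy : arc y x by have /setP/(_ y) := Nx; rewrite !inE eqxx.
have /eqP hy' : arc y' x by have /setP/(_ y') := Nx; rewrite !inE eqxx orbT.
have /eqP hx : arc x y by have /setP/(_ x) := Ny; rewrite !inE eqxx.
have /eqP hx' : arc x' y by have /setP/(_ x') := Ny; rewrite !inE eqxx orbT.
(* With u, v, w the tails of [x], [y], [x'], these are the adjacencies u to v, w to v and w to u in
   the inner line digraph. Thus u and v both start at the head of w, while u ends where v starts. *)
have/eqP ax := valP x; have/eqP ax' := valP x'; have/eqP ay' := valP y'.
rewrite /tail in tx'y'.
apply: (@tail_neq_head H (val x).1); rewrite /tail /head.
by rewrite ax hx -hx' -ax' tx'y' ay' hy'.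
Qed.

Theorem corollary2p1 (D : digraph) (k : nat)
    (D_sc : strongly_connected D) (k_ge1 : 1 <= k)
    (delta_ge2 : 2 <= min_in_degree (iter_line k D)) :
  [/\ (2 <= k -> admits_identifying_code (iter_line k D) 2),
      (k = 1 -> 3 <= min_in_degree (iter_line k D) ->
         admits_identifying_code (iter_line k D) 2)
    & (in_regular D 2 ->
         (admits_identifying_code (iter_line k D) 2 <->
          ~ exists x y x' y' : vert (iter_line k D),
              [/\ x' <> x, y' <> y,
                  in_nbr x = [set y; y'],
                  in_nbr y = [set x; x']
                & in_nbr x' :&: in_nbr y' <> set0]))].
Proof.
case: k k_ge1 delta_ge2 => // k _ delta_ge2.
have deg2 x := leq_trans delta_ge2 (@min_in_degree_le (iter_line k.+1 D) x).
split=> [k_ge2 | _ delta_ge3 | _].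
- apply: (admits_of_not_twin_digon deg2).
  by case: k k_ge2 {delta_ge2 deg2} => // k _; apply: line2_not_twin_digon.
(* A twin digon contains a vertex of in-degree at most 2. *)
- apply: (admits_of_not_twin_digon deg2) => -[x [y [x' [y' [_ _ Nx _ _]]]]].
  have := leq_trans delta_ge3 (min_in_degree_le x).
  by rewrite Nx cards2; case: (y != y').
- split; last exact: admits_of_not_twin_digon deg2.
  by move=> adm twin; apply: twin_digon_not_admits twin adm.
Qed.
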